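(* Let $\mathcal{G}$ be a magmoidal category and let $\mathcal{N}_l(\mathcal{G})$ be its left nucleus. Equip $\mathcal{N}_l(\mathcal{G})$ with the tensor product $(A,a)\otimes(B,b)=(A\otimes B,a|b)$ (on morphisms, the tensor product of the underlying morphisms of $\mathcal{G}$) and with the associativity constraint $$\phi_{(A,a),(B,b),(C,c)}=a_{B,C}:(A,a)\otimes((B,b)\otimes(C,c))\to((A,a)\otimes(B,b))\otimes(C,c).$$ Then $\mathcal{N}_l(\mathcal{G})$ is a semigroupal category.
   Context: A magmoidal category is a category $\mathcal{G}$ with a functor $\otimes:\mathcal{G}\times\mathcal{G}\to\mathcal{G}$, with no associativity or unit condition. A semigroupal category is a magmoidal category with a natural isomorphism (associativity constraint) $\phi_{X,Y,Z}:X\otimes(Y\otimes Z)\to(X\otimes Y)\otimes Z$ satisfying the pentagon axiom $\phi_{X\otimes Y,Z,W}\circ\phi_{X,Y,Z\otimes W}=(\phi_{X,Y,Z}\otimes W)\circ\phi_{X,Y\otimes Z,W}\circ(X\otimes\phi_{Y,Z,W})$ (a monoidal category without unit). An object's name also denotes its identity morphism. The left nucleus $\mathcal{N}_l(\mathcal{G})$ has as objects pairs $(A,a)$, with $A\in\mathcal{G}$ and $a$ a family of isomorphisms $a_{X,Y}:A\otimes(X\otimes Y)\to(A\otimes X)\otimes Y$ natural in $X,Y\in\mathcal{G}$. A morphism $(A,a)\to(B,b)$ is a morphism $f:A\to B$ of $\mathcal{G}$ such that $((f\otimes X)\otimes Y)\circ a_{X,Y}=b_{X,Y}\circ(f\otimes(X\otimes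 Y))$ for all $X,Y$. For $(A,a),(B,b)\in\mathcal{N}_l(\mathcal{G})$ the family $(a|b)_{X,Y}:(A\otimes B)\otimes(X\otimes Y)\to((A\otimes B)\otimes X)\otimes Y$ is defined by $$(a|b)_{X,Y}\circ a_{B,X\otimes Y}=(a_{B,X}\otimes Y)\circ a_{B\otimes X,Y}\circ(A\otimes b_{X,Y}).$$ *)

(* Defs.v *)
From Stdlib Require Import ProofIrrelevance.

Set Implicit Arguments.
Unset Strict Implicit.
Unset Printing Implicit Defensive.

Declare Scope cat_scope.
Delimit Scope cat_scope with cat.
Open Scope cat_scope.

Record category := Category {
  obj :> Type;
  hom : obj -> obj -> Type;
  id : forall X, hom X X;
  comp : forall X Y Z, hom Y Z -> hom X Y -> hom X Z;
  comp_id_l : forall X Y (f : hom X Y), comp (id Y) f = f;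
  comp_id_r : forall X Y (f : hom X Y), comp f (id X) = f;
  comp_assoc : forall X Y Z W (h : hom Z W) (g : hom Y Z) (f : hom X Y),
    comp h (comp g f) = comp (comp h g) f
}.
Arguments id {c} X.
Arguments comp {c X Y Z} g f.
Notation "g ∘ f" := (comp g f) (at level 40, left associativity) : cat_scope.

Definition is_iso (C : category) (X Y : C) (f : hom X Y) : Prop :=
  exists g : hom Y X, g ∘ f = id X /\ f ∘ g = id Y.

Definition prod_category (C D : category) : category.
Proof.
refine (@Category (C * D)
  (fun P Q => hom (fst P) (fst Q) * hom (snd P) (snd Q))%type
  (fun P => (id (fst P), id (snd P)))
  (fun P Q R g f => (fst g ∘ fst f, snd g ∘ snd f)) _ _ _).
- intros P Q [f g]; simpl; now rewrite !comp_id_l.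
- intros P Q [f g]; simpl; now rewrite !comp_id_r.
- intros P Q R S h g f; simpl; now rewrite !comp_assoc.
Defined.

Record is_functor (C D : category) (F0 : C -> D)
    (F1 : forall X Y : C, hom X Y -> hom (F0 X) (F0 Y)) : Prop := IsFunctor {
  fmap_id : forall X, F1 X X (id X) = id (F0 X);
  fmap_comp : forall X Y Z (g : hom Y Z) (f : hom X Y),
    F1 X Z (g ∘ f) = F1 Y Z g ∘ F1 X Y f
}.

Record functor (C D : category) := Functor {
  fobj :> C -> D;
  fmap : forall X Y : C, hom X Y -> hom (fobj X) (fobj Y);
  functorP : is_functor fmap
}.
Arguments fmap {C D} f {X Y} _.

Record magmoidal := Magmoidal {
  mag_cat :> category;
  tensor : functor (prod_category mag_cat mag_cat) mag_cat
}.

Definition tobj (G : magmoidal) (X Y : G) : G := tensor G (X, Y).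
Notation "X ⊗ Y" := (tobj X Y) (at level 35, no associativity) : cat_scope.

Definition tmor (G : magmoidal) (X X' Y Y' : G)
    (f : hom X X') (g : hom Y Y') : hom (X ⊗ Y) (X' ⊗ Y') :=
  @fmap _ _ (tensor G) (X, Y) (X', Y') (f, g).
Notation "f ⊠ g" := (tmor f g) (at level 35, no associativity) : cat_scope.

Record is_semigroupal (G : magmoidal)
    (phi : forall X Y Z : G, hom (X ⊗ (Y ⊗ Z)) ((X ⊗ Y) ⊗ Z)) : Prop :=
  IsSemigroupal {
  assoc_iso : forall X Y Z, is_iso (phi X Y Z);
  assoc_natural : forall (X X' Y Y' Z Z' : G)
      (f : hom X X') (g : hom Y Y') (h : hom Z Z'),
    ((f ⊠ g) ⊠ h) ∘ phi X Y Z = phi X' Y' Z' ∘ (f ⊠ (g ⊠ h));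
  pentagon : forall X Y Z W : G,
    phi (X ⊗ Y) Z W ∘ phi X Y (Z ⊗ W) =
    (phi X Y Z ⊠ id W) ∘ phi X (Y ⊗ Z) W ∘ (id X ⊠ phi Y Z W)
}.

Definition left_family (G : magmoidal) (A : G) : Type :=
  forall X Y : G, hom (A ⊗ (X ⊗ Y)) ((A ⊗ X) ⊗ Y).

Record is_natural_iso_family (G : magmoidal) (A : G) (a : left_family A) : Prop :=
  IsNaturalIsoFamily {
  family_iso : forall X Y, is_iso (a X Y);
  family_natural : forall (X X' Y Y' : G) (f : hom X X') (g : hom Y Y'),
    ((id A ⊠ f) ⊠ g) ∘ a X Y = a X' Y' ∘ (id A ⊠ (f ⊠ g))
}.

Record nucl_obj (G : magmoidal) := NuclObj {
  nobj :> G;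
  nfam : left_family nobj;
  nfamP : is_natural_iso_family nfam
}.
Arguments nfam {G} A X Y : rename.

Definition is_nucl_hom (G : magmoidal) (A B : nucl_obj G) (f : hom A B) : Prop :=
  forall X Y : G,
    ((f ⊠ id X) ⊠ id Y) ∘ nfam A X Y = nfam B X Y ∘ (f ⊠ id (X ⊗ Y)).

Record nucl_hom (G : magmoidal) (A B : nucl_obj G) := NuclHom {
  nmor : hom A B;
  nmorP : is_nucl_hom nmor
}.

Lemma nucl_hom_eq (G : magmoidal) (A B : nucl_obj G) (f g : nucl_hom A B) :
  nmor f = nmor g -> f = g.
Proof.
destruct f as [f Hf], g as [g Hg]; simpl; intros <-.
now rewrite (proof_irrelevance _ Hf Hg).
Qed.

Lemma tmor_id (G : magmoidal) (X Y : G) : id X ⊠ id Y = id (X ⊗ Y).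
Proof. exact (fmap_id (functorP (tensor G)) (X, Y)). Qed.

Lemma tmor_comp (G : magmoidal) (X X' X'' Y Y' Y'' : G)
    (f' : hom X' X'') (f : hom X X') (g' : hom Y' Y'') (g : hom Y Y') :
  (f' ∘ f) ⊠ (g' ∘ g) = (f' ⊠ g') ∘ (f ⊠ g).
Proof.
exact (@fmap_comp _ _ _ _ (functorP (tensor G)) (X, Y) (X', Y') (X'', Y'')
  (f', g') (f, g)).
Qed.

Lemma is_nucl_hom_id (G : magmoidal) (A : nucl_obj G) : is_nucl_hom (id (nobj A)).
Proof. intros X Y; now rewrite !tmor_id, comp_id_l, comp_id_r. Qed.

Lemma is_nucl_hom_comp (G : magmoidal) (A B C : nucl_obj G)
    (g : hom B C) (f : hom A B) :
  is_nucl_hom g -> is_nucl_hom f -> is_nucl_hom (g ∘ f).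
Proof.
intros Hg Hf X Y.
rewrite <- (comp_id_l (id X)), <- (comp_id_l (id Y)), !tmor_comp, <- comp_assoc, Hf.
rewrite comp_assoc, Hg, <- comp_assoc, <- tmor_comp.
now rewrite !comp_id_l.
Qed.

Definition left_nucleus (G : magmoidal) : category.
Proof.
refine (@Category (nucl_obj G) (@nucl_hom G)
  (fun A => NuclHom (@is_nucl_hom_id G A))
  (fun A B C g f => NuclHom (is_nucl_hom_comp (nmorP g) (nmorP f))) _ _ _);
  intros; apply nucl_hom_eq; simpl.
- apply comp_id_l.
- apply comp_id_r.
- apply comp_assoc.
Defined.

(* The defining equation of [a|b]; it has at most one solution [c] since the
   components of [nfam A] are isomorphisms. *)
Definition is_bar (G : magmoidal) (A B : nucl_obj G)
    (c : left_family (nobj A ⊗ nobj B)) : Prop :=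
  forall X Y : G,
    c X Y ∘ nfam A B (X ⊗ Y) =
    (nfam A B X ⊠ id Y) ∘ nfam A (B ⊗ X) Y ∘ (id (nobj A) ⊠ nfam B X Y).

(* Main.v *)
(* The components of a left family are isomorphisms, so [a|b] is obtained by
   inverting [a] in its defining equation, and every identity involving [a|b]
   may be checked after precomposition with a component of [a], where it becomes
   an instance of the naturality of [a] and [b]. The defining equation of [a|b]
   is itself the pentagon axiom of the nucleus. *)
From Stdlib Require Import IndefiniteDescription.
Require Import Defs.

Set Implicit Arguments.
Unset Strict Implicit.
Unset Printing Implicit Defensive.

(** Composites associate to the left, so [u ∘ v] is not a subterm of [x ∘ u ∘ v]; this form applies
    [E] there. *)
Lemma comp_eq_under (C : category) (X Y Z W : C) (u : hom Y Z) (v : hom X Y)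
    (w : hom X Z) (E : u ∘ v = w) (x : hom Z W) : x ∘ u ∘ v = x ∘ w.
Proof. now rewrite <- comp_assoc, E. Qed.

Lemma is_iso_epi (C : category) (X Y Z : C) (f : hom X Y) (g h : hom Y Z) :
  is_iso f -> g ∘ f = h ∘ f -> g = h.
Proof.
intros [k [_ Hk]] E.
now rewrite <- (comp_id_r g), <- (comp_id_r h), <- Hk, !comp_assoc, E.
Qed.

Lemma is_iso_id (C : category) (X : C) : is_iso (id X).
Proof. exists (id X); split; apply comp_id_l. Qed.

Lemma is_iso_comp (C : category) (X Y Z : C) (g : hom Y Z) (f : hom X Y) :
  is_iso g -> is_iso f -> is_iso (g ∘ f).
Proof.
intros [g' [Hg1 Hg2]] [f' [Hf1 Hf2]]; exists (f' ∘ g'); split; rewrite comp_assoc.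
- now rewrite (comp_eq_under Hg1), comp_id_r.
- now rewrite (comp_eq_under Hf2), comp_id_r.
Qed.

Lemma is_iso_tmor (G : magmoidal) (X X' Y Y' : G) (f : hom X X') (g : hom Y Y') :
  is_iso f -> is_iso g -> is_iso (f ⊠ g).
Proof.
intros [f' [Hf1 Hf2]] [g' [Hg1 Hg2]]; exists (f' ⊠ g').
now rewrite <- !tmor_comp, Hf1, Hf2, Hg1, Hg2, !tmor_id.
Qed.

Lemma tmor_id_comp (G : magmoidal) (A X Y Z : G) (g : hom Y Z) (f : hom X Y) :
  id A ⊠ (g ∘ f) = (id A ⊠ g) ∘ (id A ⊠ f).
Proof. now rewrite <- tmor_comp, comp_id_l. Qed.

Lemma tmor_comp_id (G : magmoidal) (A X Y Z : G) (g : hom Y Z) (f : hom X Y) :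
  (g ∘ f) ⊠ id A = (g ⊠ id A) ∘ (f ⊠ id A).
Proof. now rewrite <- tmor_comp, comp_id_l. Qed.

(** [is_iso] is a bare existence statement, while the family [a|b] is data; choice extracts the
    inverse. *)
Definition iso_inv (C : category) (X Y : C) (f : hom X Y) (Hf : is_iso f) : hom Y X :=
  proj1_sig (constructive_indefinite_description _ Hf).

Lemma iso_invP (C : category) (X Y : C) (f : hom X Y) (Hf : is_iso f) :
  iso_inv Hf ∘ f = id X /\ f ∘ iso_inv Hf = id Y.
Proof. exact (proj2_sig (constructive_indefinite_description _ Hf)). Qed.

Lemma is_iso_inv (C : category) (X Y : C) (f : hom X Y) (Hf : is_iso f) :
  is_iso (iso_inv Hf).
Proof. destruct (iso_invP Hf) as [H1 H2]; now exists f. Qed.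

(** Factor [f ⊠ (g ⊠ h)] as [f ⊠ id] followed by [id ⊠ (g ⊠ h)]: the first factor crosses by the
    morphism condition, the second by naturality of the family. *)
Lemma is_nucl_hom_natural (G : magmoidal) (A A' : nucl_obj G) (f : hom A A')
    (X X' Y Y' : G) (g : hom X X') (h : hom Y Y') :
  is_nucl_hom f ->
  ((f ⊠ g) ⊠ h) ∘ nfam A X Y = nfam A' X' Y' ∘ (f ⊠ (g ⊠ h)).
Proof.
intros Hf.
rewrite <- (comp_id_l f), <- (comp_id_r g), <- (comp_id_r h), !tmor_comp.
rewrite <- comp_assoc, Hf, comp_assoc, (family_natural (nfamP A')).
now rewrite <- comp_assoc, tmor_id.
Qed.

(** The morphism condition for the inverse follows from that of [f] after precomposition with the
    isomorphism [f ⊠ id]. *)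
Lemma is_nucl_hom_iso (G : magmoidal) (A B : left_nucleus G) (f : hom A B) :
  is_iso (nmor f) -> is_iso f.
Proof.
intros [g [Hgf Hfg]].
assert (Hg : is_nucl_hom (A := B) (B := A) g).
{ intros X Y.
  apply (is_iso_epi (f := nmor f ⊠ id (X ⊗ Y))).
  { apply is_iso_tmor; [now exists g | apply is_iso_id]. }
  rewrite <- !comp_assoc, <- (nmorP f X Y), <- tmor_comp, comp_assoc, <- !tmor_comp.
  now rewrite Hgf, !comp_id_l, !tmor_id, comp_id_l, comp_id_r. }
exists (NuclHom Hg); split; now apply nucl_hom_eq.
Qed.

Definition nucl_bar (G : magmoidal) (A B : nucl_obj G) :
    left_family (nobj A ⊗ nobj B) :=
  fun X Y => (nfam A B X ⊠ id Y) ∘ nfam A (B ⊗ X) Y ∘ (id (nobj A) ⊠ nfam B X Y)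
    ∘ iso_inv (family_iso (nfamP A) B (X ⊗ Y)).

Lemma nucl_barP (G : magmoidal) (A B : nucl_obj G) : is_bar (nucl_bar A B).
Proof.
intros X Y; unfold nucl_bar.
destruct (iso_invP (family_iso (nfamP A) B (X ⊗ Y))) as [H _].
now rewrite (comp_eq_under H), comp_id_r.
Qed.

Lemma nucl_bar_iso (G : magmoidal) (A B : nucl_obj G) (X Y : G) :
  is_iso (nucl_bar A B X Y).
Proof.
unfold nucl_bar; repeat apply is_iso_comp; try apply is_iso_inv;
  try apply is_iso_tmor; try apply is_iso_id; apply family_iso, nfamP.
Qed.

(** One computation with two uses: identities for [f], [g] give naturality of [a|b], identities for
    [h], [k] make [f ⊠ g] a morphism of the nucleus. The four morphisms cross the factors of the
    defining equation one at a time. *)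
Lemma nucl_bar_natural (G : magmoidal) (A A' B B' : nucl_obj G)
    (f : hom A A') (g : hom B B') (X X' Y Y' : G) (h : hom X X') (k : hom Y Y') :
  is_nucl_hom f -> is_nucl_hom g ->
  (((f ⊠ g) ⊠ h) ⊠ k) ∘ nucl_bar A B X Y =
  nucl_bar A' B' X' Y' ∘ ((f ⊠ g) ⊠ (h ⊠ k)).
Proof.
intros Hf Hg.
apply (is_iso_epi (family_iso (nfamP A) B (X ⊗ Y))).
rewrite (comp_eq_under (nucl_barP A B X Y)), !comp_assoc, <- tmor_comp.
rewrite (is_nucl_hom_natural _ _ Hf), comp_id_r, <- (comp_id_l k) at 1.
rewrite tmor_comp, (comp_eq_under (is_nucl_hom_natural _ _ Hf)), !comp_assoc.
rewrite <- comp_assoc, <- tmor_comp, (is_nucl_hom_natural _ _ Hg), comp_id_r.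
rewrite (comp_eq_under (is_nucl_hom_natural _ _ Hf)), comp_assoc.
rewrite (nucl_barP A' B' X' Y'), <- !comp_assoc, <- tmor_comp.
now rewrite comp_id_l.
Qed.

Lemma nucl_bar_family (G : magmoidal) (A B : nucl_obj G) :
  is_natural_iso_family (nucl_bar A B).
Proof.
split; [apply nucl_bar_iso |].
intros X X' Y Y' f g.
rewrite <- tmor_id; apply nucl_bar_natural; apply is_nucl_hom_id.
Qed.

Definition nucl_tensor (G : magmoidal) (A B : nucl_obj G) : nucl_obj G :=
  NuclObj (nucl_bar_family A B).

Lemma nucl_tensor_hom (G : magmoidal) (A A' B B' : nucl_obj G)
    (f : nucl_hom A A') (g : nucl_hom B B') :
  @is_nucl_hom G (nucl_tensor A B) (nucl_tensor A' B') (nmor f ⊠ nmor g).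
Proof.
intros X Y; rewrite <- tmor_id; apply nucl_bar_natural; apply nmorP.
Qed.

Lemma nucl_assoc_hom (G : magmoidal) (A B C : nucl_obj G) :
  @is_nucl_hom G (nucl_tensor A (nucl_tensor B C)) (nucl_tensor (nucl_tensor A B) C)
    (nfam A B C).
Proof.
intros X Y; cbn.
apply (is_iso_epi (family_iso (nfamP A) (B ⊗ C) (X ⊗ Y))).
(* The factor [id ⊠ nfam B C _] completes the right-hand side of the defining
   equation of [a|b] at [(C, X ⊗ Y)]. *)
apply (is_iso_epi (f := id (nobj A) ⊠ nfam B C (X ⊗ Y))).
{ apply is_iso_tmor; [apply is_iso_id | apply family_iso, nfamP]. }
(* A common form free of bars. The left side reaches it by the defining equations of [a|(b|c)] and
   [b|c]. *)
transitivity (((nfam A B C ⊠ id X) ⊠ id Y) ∘ (nfam A (B ⊗ C) X ⊠ id Y)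
  ∘ nfam A ((B ⊗ C) ⊗ X) Y
  ∘ (id (nobj A) ⊠ ((nfam B C X ⊠ id Y) ∘ nfam B (C ⊗ X) Y
       ∘ (id (nobj B) ⊠ nfam C X Y)))).
- rewrite (comp_eq_under (nucl_barP A (nucl_tensor B C) X Y)), <- (nucl_barP B C X Y).
  now rewrite tmor_id_comp, !comp_assoc.
(* The right side uses the equation of [(a|b)|c] and three instances of that of [a|b]; naturality of
   [a] carries [c] and then [b] past it. *)
- symmetry.
  rewrite <- !comp_assoc, (comp_assoc (nfam A B C ⊠ id (X ⊗ Y))).
  rewrite <- (nucl_barP A B C (X ⊗ Y)), comp_assoc.
  pose proof (nucl_barP (nucl_tensor A B) C X Y) as E; cbn in E; rewrite E; clear E.
  rewrite <- (tmor_id (nobj A) (nobj B)).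
  rewrite (comp_eq_under (family_natural (nfamP A) (id (nobj B)) (nfam C X Y))).
  rewrite comp_assoc, (comp_eq_under (nucl_barP A B (C ⊗ X) Y)), !comp_assoc.
  rewrite <- tmor_comp_id, (nucl_barP A B C X), !tmor_comp_id, !tmor_id_comp.
  rewrite !comp_assoc.
  now rewrite (comp_eq_under (family_natural (nfamP A) (nfam B C X) (id Y))), comp_assoc.
Qed.

Theorem theorem2p1p1 :
  forall G : magmoidal,
  exists bar : forall A B : left_nucleus G, left_family (nobj A ⊗ nobj B),
  (forall A B : left_nucleus G, is_bar (bar A B)) /\
  exists barP : forall A B : left_nucleus G, is_natural_iso_family (bar A B),
  let tens_obj (P : prod_category (left_nucleus G) (left_nucleus G)) : left_nucleus G :=
    NuclObj (barP (fst P) (snd P)) in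
  exists tensP : forall (P Q : prod_category (left_nucleus G) (left_nucleus G)) (f : hom P Q),
    @is_nucl_hom G (tens_obj P) (tens_obj Q) (nmor (fst f) ⊠ nmor (snd f)),
  let tens_hom (P Q : prod_category (left_nucleus G) (left_nucleus G)) (f : hom P Q) :
      hom (tens_obj P) (tens_obj Q) := NuclHom (tensP P Q f) in
  exists tensF : is_functor tens_hom,
  let N : magmoidal := Magmoidal (Functor tensF) in
  exists assocP : forall A B C : N,
    @is_nucl_hom G (A ⊗ (B ⊗ C)) ((A ⊗ B) ⊗ C) (nfam A (nobj B) (nobj C)),
  is_semigroupal (G := N) (fun A B C : N => NuclHom (assocP A B C)).
Proof.
intros G.
exists (@nucl_bar G); split; [exact (@nucl_barP G) |].
exists (@nucl_bar_family G); intros tens_obj.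
exists (fun P Q f => nucl_tensor_hom (fst f) (snd f)); intros tens_hom.
assert (tensF : is_functor tens_hom).
{ split.
  - intros P; apply nucl_hom_eq, tmor_id.
  - intros P Q R g f; apply nucl_hom_eq, tmor_comp. }
exists tensF; intros N.
exists (@nucl_assoc_hom G).
split.
- intros A B C; apply is_nucl_hom_iso, family_iso, nfamP.
- intros A A' B B' C C' f g h; apply nucl_hom_eq.
  apply (is_nucl_hom_natural (nmor g) (nmor h) (nmorP f)).
(* The constraint at [A ⊗ B] is a component of [nucl_bar A B], so this is the defining equation at
   [(C, D)]. *)
- intros A B C D; apply nucl_hom_eq, nucl_barP.
Qed.
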